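(* For every integer $L$ with $5 \leq L \leq 10$, all coefficients of the formal power series $G_{L,2}(q)+q^3$ are nonnegative.
   Context: A partition $\pi$ is a weakly decreasing finite list of positive integers (its parts); $|\pi|$ denotes the sum of its parts. Let $\mho$ be the set of partitions $\pi$ with $|\pi|>0$, and for $\pi \in \mho$ let $s(\pi)$ and $l(\pi)$ denote the smallest and largest parts of $\pi$, respectively. For a positive integer $L$, define $$G_{L,2}(q) = \sum_{\substack{\pi \in \mho,\\ s(\pi)=2,\\ l(\pi)-s(\pi)\leq L}} q^{|\pi|} - \sum_{\substack{\pi \in \mho,\\ s(\pi)\geq 3,\\ l(\pi)-s(\pi)\leq L}} q^{|\pi|}.$$ *)

(* Defs.v *)
From mathcomp Require Import all_boot all_order all_algebra.

Set Implicit Arguments.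
Unset Strict Implicit.
Unset Printing Implicit Defensive.

Import Order.TTheory GRing.Theory Num.Theory.
Local Open Scope ring_scope.

Definition is_partition (p : seq nat) : bool :=
  sorted geq p && all (fun i => 0 < i)%N p.

Definition weight (p : seq nat) : nat := sumn p.

Definition mho : pred (seq nat) := [pred p | is_partition p & (0 < weight p)%N].

(* Only meaningful for nonempty p: both are 0 on [::]. *)
Definition largest (p : seq nat) : nat := (\max_(i <- p) i)%N.
Definition smallest (p : seq nat) : nat := \big[minn/largest p]_(i <- p) i.

(* The partitions of n, each listed once (mem_partitions, uniq_partitions):
   they have at most n parts, all of them at most n. *)
Definition partitions (n : nat) : seq (seq nat) :=
  [seq p <- [seq map val (bseqval b) | b <- enum {: n.-bseq 'I_n.+1}] |
     is_partition p & weight p == n].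

Lemma uniq_partitions n : uniq (partitions n).
Proof.
apply: filter_uniq; rewrite map_inj_uniq ?enum_uniq // => b c.
by move/(inj_map val_inj)/val_inj.
Qed.

Lemma mem_partitions n p :
  (p \in partitions n) = is_partition p && (weight p == n).
Proof.
rewrite mem_filter; apply: andb_idr => /andP[/andP[_ pos_p] /eqP wp].
have size_p : (size p <= n)%N.
  rewrite -wp /weight; elim: p pos_p {wp} => //= i p IHp /andP[i_gt0 /IHp].
  by move=> le_p; rewrite -add1n leq_add.
have le_p : all (fun i => i < n.+1)%N p.
  rewrite -wp /weight; apply/allP => i; elim: p {pos_p wp size_p} => //= j p IHp.
  rewrite inE ltnS => /predU1P[-> | /IHp]; first exact: leq_addr.
  by rewrite ltnS => /leq_trans; apply; apply: leq_addl.
have size_q : (size (map (@inord n) p) <= n)%N by rewrite size_map.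
apply/mapP; exists (Bseq size_q); first by rewrite mem_enum.
rewrite /= -map_comp -[LHS]map_id; apply/eq_in_map => i /(allP le_p) lt_i.
by rewrite /= inordK.
Qed.

(* A formal power series in q with integer coefficients is given by its
   coefficient function; addition and subtraction of series are the pointwise
   \+ and \-. *)
Definition fps : Type := nat -> int.

Definition qpow (k : nat) : fps := fun n => (n == k)%:R.

(* The sum of q^|p| over all partitions p satisfying P. *)
Definition partition_series (P : pred (seq nat)) : fps :=
  fun n => (count P (partitions n))%:Z.

Definition G2 (L : nat) : fps :=
  partition_series [pred p | [&& p \in mho, smallest p == 2
                               & (largest p - smallest p <= L)%N]]
  \- partition_series [pred p | [&& p \in mho, (3 <= smallest p)%N
                                  & (largest p - smallest p <= L)%N]].

(* Main.v *)
From Stdlib Require Import ZArith.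
Require Import Defs.
From mathcomp Require Import all_boot all_order all_algebra.
From mathcomp Require Import zify ssrZ ring.

Set Implicit Arguments.
Unset Strict Implicit.
Unset Printing Implicit Defensive.

Import Order.TTheory GRing.Theory Num.Theory.
Local Open Scope ring_scope.

(** The series G_{L,2} + q^3 is a rational function whose poles are roots of
unity, so its coefficients are eventually a quasi-polynomial, and the proof
reduces their positivity to a finite check.

Rationality.  Write F_s for the series of the partitions with smallest part s
and largest part at most s + L, and T_s for that of the partitions with all
parts in [s, s + L).  Taking parts s and s + L away from the partitions with
all parts in [s, s + L] gives (1 - q^L) F_s = T_s - T_{s+1} ([dif_band]).
Summed over s >= 3 this telescopes: the partitions with s(p) >= 3 and l(p) -
s(p) <= L have a series B with (1 - q^L) B = T_3 - 1 ([dif_span3]). Since T_3 =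
1 / ((1 - q^3) ... (1 - q^(L+2))), the product of G_{L,2} + q^3 by (1 - q^L) (1
- q^2) ... (1 - q^(L+2)) is a polynomial ([vanish_G2]).

Positivity.  If (1 - q^b) f has nonnegative coefficients from index M on, and f
has nonnegative coefficients on the window [M, M + b), then f has nonnegative
coefficients from M on, as f_n = f_{n-b} + ((1 - q^b) f)_n ([nonneg_from]).
Multiplying f successively by the factors of its denominator ends with a
polynomial, that is with 0 from some index on; so one window for each
intermediate product is enough ([windows_ge0]), provided that all these
products are eventually nonnegative.  This is where the choice of the factors
and their order matter.  The pole of G_{L,2} at q = 1 has order L + 1 and a
positive leading coefficient, proportional to 1 - 2 / L, and it should stay
dominant in every intermediate product.  It does while the factors 1 - q^L, 1 -
q^6, ..., 1 - q^(L+2) are removed.  Since the numerator vanishes at 1, removing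
1 - q^2, ..., 1 - q^5 one by one could let the poles at other roots of unity
catch up; so each of these four is replaced by its multiple 1 - q^60, which
lowers the orders of all the remaining poles together ([vanish_difs_dvd]).  The
windows and the finitely many initial coefficients are then computed with
binary integers. *)

(** * Multiplication of a series by 1 - q^a *)

Definition shift (a : nat) (f : fps) : fps :=
  fun n => if (a <= n)%N then f (n - a)%N else 0.
Definition dif (a : nat) (f : fps) : fps := f \- shift a f.
Definition difs (s : seq nat) (f : fps) : fps := foldr dif f s.

Lemma eq_shift a f g : f =1 g -> shift a f =1 shift a g.
Proof. by move=> fg n; rewrite /shift fg. Qed.

Lemma shift_shift a b f : shift a (shift b f) =1 shift (a + b) f.
Proof.
move=> n; rewrite /shift; case: (leqP a n) => [an|na]; last by rewrite leqNgt ltn_addr.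
by rewrite leq_subRL // subnDA.
Qed.

Lemma shiftB a f g : shift a (f \- g) =1 shift a f \- shift a g.
Proof. by move=> n; rewrite /= /shift; case: ifP => // _; rewrite subrr. Qed.

Lemma eq_dif a f g : f =1 g -> dif a f =1 dif a g.
Proof. by move=> fg n; rewrite /dif /= fg (eq_shift a fg). Qed.

Lemma difB a f g : dif a (f \- g) =1 dif a f \- dif a g.
Proof. by move=> n; rewrite /dif /= shiftB /=; ring. Qed.

Lemma difC a b f : dif a (dif b f) =1 dif b (dif a f).
Proof.
move=> n; rewrite /dif /= !shiftB /= !shift_shift addnC; ring.
Qed.

Lemma eq_difs s f g : f =1 g -> difs s f =1 difs s g.
Proof. by move=> fg; elim: s => //= a s; apply: eq_dif. Qed.

Lemma difsB s f g : difs s (f \- g) =1 difs s f \- difs s g.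
Proof. by elim: s => //= a s IHs n; rewrite (eq_dif a IHs) difB. Qed.

Lemma difs_dif s a f : difs s (dif a f) =1 dif a (difs s f).
Proof. by elim: s => //= b s IHs n; rewrite (eq_dif b IHs) difC. Qed.

(** The series f is a polynomial of degree less than d. *)
Definition vanish (d : nat) (f : fps) := forall n, (d <= n)%N -> f n = 0.

Lemma vanish_dif d a f : vanish d f -> vanish (a + d) (dif a f).
Proof.
move=> vf n dn; rewrite /dif /= /shift !vf ?if_same ?subrr //.
- by lia.
- by lia.
Qed.

Lemma vanish_difs d s f : vanish d f -> vanish (sumn s + d) (difs s f).
Proof. by move=> vf; elim: s => //= a s IHs; rewrite -addnA; apply: vanish_dif. Qed.

(** The factorization of 1 - q^(m a) as
(1 + q^a + ... + q^((m-1) a)) (1 - q^a). *)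
Lemma dif_mul m a f n : dif (m * a) f n = \sum_(j < m) shift (j * a) (dif a f) n.
Proof.
elim: m => [|m IHm]; first by rewrite big_ord0 /dif /= /shift /= subn0 subrr.
rewrite big_ord_recr /= -IHm /dif /= shiftB /= shift_shift mulSn addnC; ring.
Qed.

Lemma eq_vanish d f g : f =1 g -> vanish d f -> vanish d g.
Proof. by move=> fg vf n /vf; rewrite fg. Qed.

Lemma vanish_le d e f : (d <= e)%N -> vanish d f -> vanish e f.
Proof. by move=> de vf n en; apply: vf; apply: leq_trans de en. Qed.

Lemma vanishB d f g : vanish d f -> vanish d g -> vanish d (f \- g).
Proof. by move=> vf vg n dn; rewrite /= vf ?vg ?subrr. Qed.

Lemma vanish_qpow k : vanish k.+1 (qpow k).
Proof. by move=> n; rewrite /qpow; case: eqP => // ->; rewrite ltnn. Qed.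

Lemma difs_catC s t f : difs (s ++ t) f =1 difs (t ++ s) f.
Proof.
rewrite /difs !foldr_cat -!/(difs _ _); elim: s => //= a s IHs n.
by rewrite (eq_dif a IHs) difs_dif.
Qed.

Lemma vanish_dif_dvd d a b f :
  (0 < b)%N -> (a %| b)%N -> vanish (a + d) (dif a f) -> vanish (b + d) (dif b f).
Proof.
move=> b0 /dvdnP[m bE] vf n dn; rewrite bE dif_mul big1 // => -[j ltjm] _ /=.
rewrite /shift; case: ifP => // _; apply: vf.
have: (j.+1 * a <= m * a)%N by rewrite leq_mul2r ltjm orbT.
rewrite mulSn; lia.
Qed.

(** A factor 1 - q^a of a denominator may be replaced by any multiple 1 - q^b,
because (1 - q^b) / (1 - q^a) is a polynomial of degree b - a; this is why the
degree bound changes from sumn s + d to sumn t + d. *)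
Lemma vanish_difs_dvd d s t f :
  all (leq 1) t -> all2 dvdn s t ->
  vanish (sumn s + d) (difs s f) -> vanish (sumn t + d) (difs t f).
Proof.
elim: s t d f => [|a s IHs] [|b t] //= d f /andP[b0 t0] /andP[ab st] vf.
rewrite -addnA; apply: vanish_dif_dvd ab _ => //.
apply: eq_vanish (difs_dif t a f) _; rewrite addnCA; apply: IHs => //.
apply: eq_vanish (fun n => esym (difs_dif s a f n)) _.
by rewrite addnA [(sumn s + a)%N]addnC.
Qed.

(** * Removing one part from a partition *)

Definition parts_series (Q : pred nat) : fps := partition_series (all Q).

Lemma sort_geq_partition p : all (fun i => 0 < i)%N p -> is_partition (sort geq p).
Proof.
move=> pos; rewrite /is_partition all_sort pos andbT.
by apply: sort_sorted => x y; apply: leq_total.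
Qed.

Lemma partition_eq_perm p q : is_partition p -> is_partition q -> perm_eq p q -> p = q.
Proof.
move=> /andP[sp _] /andP[sq _].
apply: (sorted_eq (leT := geq)) => //.
  by move=> x y z yx zy; apply: leq_trans zy yx.
by move=> x y; rewrite andbC => /anti_leq.
Qed.

Lemma weight_perm p q : perm_eq p q -> weight p = weight q.
Proof. exact: perm_sumn. Qed.

(** Inserting a part v is a bijection from the partitions of n - v with parts
in Q to those partitions of n with parts in Q that contain v; its inverse
deletes one occurrence of v. *)
Lemma parts_series_remove (Q : pred nat) v :
  (0 < v)%N -> Q v -> dif v (parts_series Q) =1 parts_series (predI Q (predC1 v)).
Proof.
move=> v0 Qv n; apply/eqP; rewrite /dif /= subr_eq /parts_series /partition_series /shift.
(* ins inserts the part v at its place in a partition *)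
pose ins p := sort geq (v :: p).
have permins p : perm_eq (ins p) (v :: p) by rewrite perm_sort.
have partins p : is_partition p -> is_partition (ins p).
  by case/andP=> _ pp; apply: sort_geq_partition; rewrite /= v0.
have wins p : weight (ins p) = (v + weight p)%N by rewrite (weight_perm (permins p)).
have allins p : all Q (ins p) = all Q p by rewrite all_sort /= Qv.
have uf m P : uniq [seq p <- partitions m | P p].
  exact: filter_uniq (uniq_partitions m).
have memf m P q : q \in [seq p <- partitions m | P p]
    = P q && (is_partition q && (weight q == m)).
  by rewrite (mem_filter P) mem_partitions.
(* the images under ins, written so that the list is empty when n < v *)
have -> : (if (v <= n)%N then (count (all Q) (partitions (n - v)))%:Z else 0)
   = (size [seq ins p | p <- partitions (n - v) & all Q p && (v <= n)%N])%:Z.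
  rewrite size_map size_filter; case: (v <= n)%N.
    by rewrite (@eq_count _ _ (all Q)) // => p; rewrite /= andbT.
  by rewrite (@eq_count _ _ pred0) ?count_pred0 // => p; rewrite /= andbF.
rewrite -!size_filter -PoszD -size_cat eqz_nat; apply/eqP/perm_size/uniq_perm.
- exact: uf.
- rewrite cat_uniq uf /=; apply/andP; split.
    apply/hasPn => _ /mapP[p _ ->]; rewrite memf negb_and; apply/orP; left.
    apply/allPn; exists v; first by rewrite (perm_mem (permins p)) mem_head.
    by rewrite /= eqxx andbF.
  rewrite map_inj_in_uniq ?uf // => p q.
  rewrite !memf => /and3P[_ pp _] /and3P[_ qq _] eqins.
  apply: partition_eq_perm => //; rewrite -(perm_cons v).
  by rewrite -(permPl (permins p)) eqins permins.
move=> p; rewrite mem_cat !memf.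
rewrite -/(all Q p) -/(all (predI Q (predC1 v)) p).
have [vp|vNp] := boolP (v \in p); last first.
  have -> : all (predI Q (predC1 v)) p = all Q p.
    apply: eq_in_all => i ip /=; case: eqP => [iv|_]; last by rewrite andbT.
    by rewrite -iv ip in vNp.
  rewrite -[LHS]orbF; congr (_ || _); apply/esym/mapP => -[q _ pq].
  by rewrite pq (perm_mem (permins q)) mem_head in vNp.
have -> : all (predI Q (predC1 v)) p = false.
  by apply/negbTE/allPn; exists v => //=; rewrite eqxx andbF.
apply/and3P/mapP => [[Qp pp /eqP wp]|[q + ->]].
  have permp : perm_eq p (v :: rem v p) by apply: perm_to_rem.
  have rpart : is_partition (rem v p).
    case/andP: pp => sp pos; apply/andP; split.
      apply: (subseq_sorted _ (rem_subseq v p)) => // x y z yx zy.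
      exact: leq_trans zy yx.
    by apply/allP => i /mem_rem; apply: (allP pos).
  have wr : n = (v + weight (rem v p))%N by rewrite -wp (weight_perm permp).
  exists (rem v p); last first.
    by apply: partition_eq_perm; rewrite ?partins // (permPl permp) perm_sym permins.
  rewrite memf rpart wr leq_addr addKn eqxx !andbT.
  by apply/allP => i /mem_rem; apply: (allP Qp).
rewrite memf => /andP[/andP[Qq vn] /andP[qq /eqP wq]].
by rewrite allins partins // wins wq subnKC.
Qed.

(** * Partitions with parts in an interval *)

Definition parts_in (s k : nat) : fps := parts_series (fun i => s <= i < s + k)%N.

Lemma eq_parts_series Q R : Q =1 R -> parts_series Q =1 parts_series R.
Proof.
by move=> QR n; congr Posz; apply: eq_count => p; apply: eq_all.
Qed.

Lemma dif_parts_in_low s k :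
  (0 < s)%N -> dif s (parts_in s k.+1) =1 parts_in s.+1 k.
Proof.
move=> s0 n; rewrite parts_series_remove //; last by lia.
by apply: eq_parts_series => i /=; lia.
Qed.

Lemma dif_parts_in_high s k :
  (0 < s)%N -> dif (s + k) (parts_in s k.+1) =1 parts_in s k.
Proof.
move=> s0 n; rewrite parts_series_remove //; [|by lia|by lia].
by apply: eq_parts_series => i /=; lia.
Qed.

Lemma parts_in0 s : parts_in s 0 =1 qpow 0.
Proof.
move=> n; rewrite /parts_in /parts_series /partition_series.
rewrite (@eq_count _ _ (pred1 [::])); last first.
  by case=> //= i p; rewrite addn0; case: leqP => //=; rewrite ltnNge => ->.
rewrite count_uniq_mem ?uniq_partitions // mem_partitions /=.
by rewrite /qpow eq_sym natz.
Qed.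

(** The Euler product: parts_in s k is the inverse of
(1 - q^s) (1 - q^(s+1)) ... (1 - q^(s+k-1)). *)
Lemma difs_parts_in s k : (0 < s)%N -> difs (iota s k) (parts_in s k) =1 qpow 0.
Proof.
elim: k s => [|k IHk] s s0 n /=; first exact: parts_in0.
by rewrite -difs_dif (eq_difs _ (dif_parts_in_low k s0)) IHk.
Qed.

Lemma parts_in_small s k n : (n < s)%N -> parts_in s k n = qpow 0 n.
Proof.
move=> ns; elim: k => [|k IHk]; first exact: parts_in0.
rewrite -IHk -[RHS]dif_parts_in_high; last by lia.
by rewrite /dif /= /shift ifF ?subr0 //; lia.
Qed.

(** The partitions with smallest part s and largest part at most s + L are the
partitions with parts in [s, s + L] of which not all parts exceed s; see
[bandE]. *)
Definition band (L s : nat) : fps := parts_in s L.+1 \- parts_in s.+1 L.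

(** As band L s is q^s C for C := parts_in s L.+1, the left side is
q^s C - q^(s+L) C = (1 - q^(s+L)) C - (1 - q^s) C, and each of the two factors
removes one end of the interval of parts of C. *)
Lemma dif_band L s :
  (0 < s)%N -> dif L (band L s) =1 parts_in s L \- parts_in s.+1 L.
Proof.
move=> s0 n; rewrite /= -(dif_parts_in_high L s0) -(dif_parts_in_low L s0).
have band_shift : band L s =1 shift s (parts_in s L.+1).
  by move=> m; rewrite /band /= -(dif_parts_in_low L s0) /dif /=; ring.
rewrite (eq_dif L band_shift) /dif /= shift_shift [(L + s)%N]addnC; ring.
Qed.

(** * Partitions with a bounded span *)

Lemma bigminP x p :
  (\big[minn/x]_(i <- p) i \in x :: p) &&
  all (leq (\big[minn/x]_(i <- p) i)) (x :: p).
Proof.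
elim: p => [|y p]; first by rewrite big_nil mem_head /= leqnn.
rewrite big_cons; move: (\big[_/_]_(i <- _) _) => m.
rewrite /= !inE => /and3P[mp mx /allP mall]; apply/and4P; split.
- rewrite /minn; case: ifP => _; rewrite ?eqxx ?orbT //.
  by case/orP: mp => ->; rewrite ?orbT.
- by rewrite geq_min mx orbT.
- by rewrite geq_minl.
- by apply/allP => i /mall; rewrite geq_min => ->; rewrite orbT.
Qed.

Lemma largest_mem p : p != [::] -> largest p \in p.
Proof.
rewrite /largest; elim: p => // x [|y p] IHp _; first by rewrite big_seq1 inE.
rewrite big_cons inE /maxn; case: ifP => _; last by rewrite eqxx.
by rewrite IHp ?orbT.
Qed.

Lemma largest_ge p i : i \in p -> (i <= largest p)%N.
Proof. by move=> ip; rewrite /largest (@leq_bigmax_seq _ _ _ id). Qed.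

Lemma smallest_mem p : p != [::] -> smallest p \in p.
Proof.
move=> pn0; have /andP[+ _] := bigminP (largest p) p.
by rewrite inE => /predU1P[|//]; rewrite -/(smallest p) => ->; apply: largest_mem.
Qed.

Lemma smallest_le p i : i \in p -> (smallest p <= i)%N.
Proof. by have /andP[_ /= /andP[_ /allP/(_ i)]] := bigminP (largest p) p. Qed.

Lemma weight_ge p i : i \in p -> (i <= weight p)%N.
Proof.
move=> ip; rewrite (weight_perm (perm_to_rem ip)) /weight /=; exact: leq_addr.
Qed.

Lemma in_mho p : (p \in mho) = is_partition p && (0 < weight p)%N.
Proof. by []. Qed.

(** Among nonempty partitions, those with all parts in [s, s + L] split into
those with smallest part s and those with all parts in [s + 1, s + L]; the empty
partition is counted by both interval series and cancels. *)
Lemma bandE L s : (0 < s)%N ->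
  partition_series [pred p | [&& p \in mho, smallest p == s
                               & (largest p - smallest p <= L)%N]] =1 band L s.
Proof.
move=> s0 n; apply/esym/eqP; rewrite /band /= subr_eq.
rewrite /parts_in /parts_series /partition_series.
rewrite -PoszD -count_predUI eqz_nat.
rewrite [X in (_ == _ + X)%N](@eq_count _ _ pred0) ?count_pred0 ?addn0; last first.
  case=> [|i q]; first by [].
  move: (i :: q) (isT : i :: q != [::]) => p pn0 /=.
  apply/negbTE; apply/negP => /andP[/and3P[_ /eqP sm _] /allP/(_ _ (smallest_mem pn0))].
  by rewrite sm ltnn.
apply/eqP/eq_in_count => p; rewrite mem_partitions => /andP[pp _] /=.
case: p pp => [|i q]; first by [].
move: (i :: q) (isT : i :: q != [::]) => p pn0 pp.
have -> : p \in mho.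
  rewrite in_mho pp; case/andP: pp => _ /allP/(_ _ (smallest_mem pn0)).
  by move=> h; apply: leq_trans h (weight_ge (smallest_mem pn0)).
have sp := smallest_mem pn0; have lp := largest_mem pn0.
rewrite /=; apply/allP/orP => [inb|[/andP[/eqP <- lL]|/allP inb] i0 i0p].
- have [/eqP sm|sm] := boolP (smallest p == s); [left|right].
    by have := inb _ lp; rewrite sm; lia.
  apply/allP => j jp; have := inb _ jp; have := inb _ sp; have := smallest_le jp.
  lia.
- have := smallest_le i0p; have := largest_ge i0p; lia.
- by have := inb _ i0p; lia.
Qed.

Lemma partition_series_band L m n : (n < m)%N ->
  partition_series [pred p | [&& p \in mho, (3 <= smallest p)%N
                                  & (largest p - smallest p <= L)%N]] n
  = \sum_(3 <= s < m) band L s n.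
Proof.
move=> nm; under eq_big_nat => s /andP[s3 _].
  rewrite -bandE; last by lia.
  over.
rewrite /partition_series -(big_morph Posz PoszD (erefl _)); congr Posz.
rewrite -sum1_count big_mkcond /=.
under [RHS]eq_bigr => s _ do rewrite -sum1_count big_mkcond /=.
rewrite exchange_big /= big_seq [RHS]big_seq; apply: eq_bigr => p.
rewrite mem_partitions => /andP[_ /eqP wp].
have [/andP[pm lL]|nP] :=
  boolP ((p \in mho) && (largest p - smallest p <= L)%N); last first.
  rewrite big1 => [|s _]; last by case: ifP nP => // /and3P[-> _ ->].
  by case: ifP nP => // /and3P[-> _ ->].
rewrite pm lL /= andbT.
have sn : (smallest p < m)%N.
  apply: leq_ltn_trans nm; rewrite -wp; apply/weight_ge/smallest_mem.
  by case: (p) pm.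
under eq_bigr => s _ do rewrite andbT.
rewrite -big_mkcond sum1_count (@eq_count _ _ (pred1 (smallest p))); last first.
  by move=> s; apply: eq_sym.
by rewrite count_uniq_mem ?iota_uniq // mem_index_iota sn andbT; case: leqP.
Qed.

Definition span3 (L : nat) : fps :=
  partition_series [pred p | [&& p \in mho, (3 <= smallest p)%N
                                & (largest p - smallest p <= L)%N]].

(** The sum of dif_band over s >= 3 telescopes.  Its last term at index n
is parts_in s L for some s > n, to which only the empty partition contributes,
hence the constant series qpow 0. *)
Lemma dif_span3 L : dif L (span3 L) =1 parts_in 3 L \- qpow 0.
Proof.
move=> n /=.
(* one range of s, long enough for n, serves for both n and n - L *)
have sum_n m : (m <= n)%N -> span3 L m = \sum_(3 <= s < n + 3) band L s m.
  by move=> mn; apply: partition_series_band; lia.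
have -> : dif L (span3 L) n = \sum_(3 <= s < n + 3) dif L (band L s) n.
  rewrite sumrB -sum_n // /dif /= /shift; case: ifP => _; last by rewrite big1.
  by rewrite -sum_n ?leq_subr.
rewrite (@eq_big_nat _ _ _ _ _ _ (fun s => - (parts_in s.+1 L n - parts_in s L n))).
  rewrite sumrN (telescope_sumr (fun s => parts_in s L n)) ?leq_addl //.
  by rewrite [parts_in (n + 3) L n]parts_in_small ?opprB //; lia.
by move=> s /andP[s3 _]; rewrite dif_band ?opprB //; lia.
Qed.

Lemma G2E L : G2 L =1 (parts_in 2 L.+1 \- parts_in 3 L) \- span3 L.
Proof. by move=> n; rewrite /G2 /= bandE. Qed.

(** The exponents L, 2, 3, ..., L + 2 of the denominator, with the factors that
the certificate replaces by 1 - q^60 placed last. *)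
Definition denoms (L : nat) : seq nat := L :: iota 6 (L - 3) ++ [:: 2; 3; 4; 5].

(** By dif_span3, multiplication by 1 - q^L expresses span3 L through the Euler
product parts_in 3 L, so that denoms L clears the denominators of all three
terms of G2E.  The summand 4 bounds the degree of qpow 3, and covers the other
numerators. *)
Lemma vanish_G2 L : (5 <= L)%N ->
  vanish (sumn (denoms L) + 4) (difs (denoms L) (G2 L \+ qpow 3)).
Proof.
move=> L5; set D := L :: iota 2 L.+1.
have DE : D = L :: [:: 2; 3; 4; 5] ++ iota 6 (L - 3).
  rewrite /D; congr cons; rewrite -(iotaD 2 4); congr iota; lia.
have sumD : sumn (denoms L) = sumn D by rewrite DE /= sumn_cat /=; lia.
have difD f : difs (denoms L) f =1 difs D f.
  by move=> n; rewrite DE /= -/(difs _ _); apply/eq_dif => m; apply: difs_catC.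
have GE : G2 L \+ qpow 3 =1 (parts_in 2 L.+1 \- parts_in 3 L) \- (span3 L \- qpow 3).
  by move=> n; rewrite /= G2E /=; ring.
rewrite sumD; apply: eq_vanish (fun n => esym (difD _ n)) _.
apply: eq_vanish (fun n => esym (eq_difs D GE n)) _.
have one : vanish 1 (qpow 0) by apply: vanish_qpow.
have v2 : vanish (sumn D + 4) (difs D (parts_in 2 L.+1)).
  apply: (@vanish_le (L + 1)); first by rewrite /D /=; lia.
  apply: eq_vanish (eq_dif L (fun n => esym (difs_parts_in L.+1 (isT : 0 < 2)%N n))) _.
  exact: vanish_dif.
have v3s : vanish (2 + 1) (difs (iota 2 L.+1) (parts_in 3 L)).
  apply: eq_vanish (eq_dif 2 (fun n => esym (difs_parts_in L (isT : 0 < 3)%N n))) _.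
  exact: vanish_dif.
have v3 : vanish (sumn D + 4) (difs D (parts_in 3 L)).
  apply: (@vanish_le (L + (2 + 1))); first by rewrite /D /=; lia.
  exact: vanish_dif.
have vB : vanish (sumn D + 4) (difs D (span3 L)).
  apply: eq_vanish (difs_dif (iota 2 L.+1) L _) _.
  apply: eq_vanish (fun n => esym (eq_difs _ (@dif_span3 L) n)) _.
  apply: eq_vanish (fun n => esym (difsB _ _ _ n)) _; apply: vanishB.
    by apply: vanish_le _ v3s; rewrite /D /=; lia.
  by apply: vanish_le _ (vanish_difs one); rewrite /D /=; lia.
have vq : vanish (sumn D + 4) (difs D (qpow 3)) by apply/vanish_difs/vanish_qpow.
by do 2!(apply: eq_vanish (fun n => esym (difsB _ _ _ n)) _; apply: vanishB).
Qed.

(** * Initial coefficients as lists of binary integers *)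

Definition lists (l : seq Z) (f : fps) :=
  forall n, (n < size l)%N -> Z_of_int (f n) = nth Z0 l n.

Definition subZ (l m : seq Z) := [seq Z.sub x.1 x.2 | x <- zip l m].
Definition deltaZ (K k : nat) : seq Z := mkseq (fun n => if n == k then Z.one else Z0) K.
Definition mulZ (a : nat) (l : seq Z) := subZ l (nseq a Z0 ++ l).

(** The accumulator holds the coefficients of the quotient in reverse order, so
that the coefficient a places before the next one is its entry a.-1, which is
absent, and read as 0, for the first a coefficients. *)
Definition divZ (a : nat) (l : seq Z) :=
  rev (foldl (fun acc x => Z.add x (nth Z0 acc a.-1) :: acc) [::] l).

Lemma lists_sub l m f g : lists l f -> lists m g -> lists (subZ l m) (f \- g).
Proof.
move=> lf mg n; rewrite size_map => nlm.
rewrite (nth_map (Z0, Z0)) // nth_zip_cond nlm /=.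
by move: nlm; rewrite size_zip leq_min => /andP[nl nm]; rewrite -lf // -mg //; lia.
Qed.

Lemma lists_delta K k : lists (deltaZ K k) (qpow k).
Proof. by move=> n; rewrite size_mkseq => nK; rewrite nth_mkseq // /qpow; case: eqP. Qed.

Lemma lists_mul a l f : lists l f -> lists (mulZ a l) (dif a f).
Proof.
move=> lf; apply: lists_sub => // n; rewrite size_cat size_nseq => nl.
rewrite nth_cat size_nseq nth_nseq if_same /shift.
by case: (leqP a n) => an //; rewrite lf // -(ltn_add2l a) subnKC.
Qed.

Lemma lists_div a l f g : (0 < a)%N -> dif a f =1 g -> lists l g -> lists (divZ a l) f.
Proof.
rewrite /divZ => a0 fg; set step := fun _ => _; set q := foldl step [::].
have qrcons l' x : q (rcons l' x) = Z.add x (nth Z0 (q l') a.-1) :: q l'.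
  by rewrite /q foldl_rcons.
have szq l' : size (q l') = size l'.
  by elim/last_ind: l' => //= l' x IHl; rewrite qrcons size_rcons /= IHl.
elim/last_ind: l => // l x IHl lg n.
have {}IHl : lists (rev (q l)) f.
  by apply: IHl => k kl; rewrite lg ?size_rcons ?nth_rcons ?kl //; lia.
rewrite qrcons rev_cons size_rcons size_rev szq nth_rcons size_rev szq ltnS leq_eqVlt.
case/predU1P => [->|nl]; last by rewrite nl IHl ?size_rev ?szq.
rewrite ltnn eqxx; have := fg (size l); have := lg (size l).
rewrite size_rcons nth_rcons ltnn eqxx => /(_ (leqnn _)).
rewrite /dif /= /shift; case: (leqP a (size l)) => al; last first.
  by rewrite [nth Z0 _ _]nth_default ?szq; [move=> <- <-; lia | lia].
have := IHl (size l - a)%N; rewrite size_rev szq nth_rev ?szq; last by lia.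
have -> : (size l - (size l - a).+1 = a.-1)%N by lia.
move=> /(_ ltac:(lia)) <- <- <-; lia.
Qed.

(** * The positivity certificate *)

Lemma nonneg_from M b f :
  (0 < b)%N ->
  (forall n, (M <= n < M + b)%N -> 0 <= f n) ->
  (forall n, (M <= n)%N -> 0 <= dif b f n) ->
  forall n, (M <= n)%N -> 0 <= f n.
Proof.
move=> b0 win df n; have [k] := ubnP n; elim: k n => // k IHk n nk Mn.
have [nb|bn] := ltnP n (M + b); first by apply: win; rewrite Mn.
have := df n Mn; rewrite /dif /= /shift ifT; last by lia.
by rewrite subr_ge0; apply/le_trans/IHk; lia.
Qed.

Fixpoint windows (M : nat) (s : seq nat) (l : seq Z) : bool :=
  if s is b :: s' then
    [&& (0 < b)%N, (M + b <= size l)%N, all (Z.leb 0) (take b (drop M l))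
      & windows M s' (mulZ b l)]
  else true.

Lemma lists_ge0 l f i j : lists l f -> (i + j <= size l)%N ->
  all (Z.leb 0) (take j (drop i l)) -> forall n, (i <= n < i + j)%N -> 0 <= f n.
Proof.
move=> lf szl /(all_nthP Z0) ge0 n /andP[i_n nij].
have szt : size (take j (drop i l)) = j by rewrite size_takel // size_drop; lia.
have := ge0 (n - i)%N; rewrite szt nth_take ?nth_drop ?subnKC; try lia.
move=> /(_ ltac:(lia)); rewrite -lf; lia.
Qed.

Lemma windows_ge0 M s l f : lists l f -> vanish M (difs s f) -> windows M s l ->
  forall n, (M <= n)%N -> 0 <= f n.
Proof.
elim: s l f => [|b s IHs] l f lf /=; first by move=> vf _ n Mn; rewrite vf.
move=> vf /and4P[b0 szl win wins]; apply: (nonneg_from b0).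
  exact: lists_ge0 szl win.
apply: IHs wins; first exact: lists_mul.
by apply: eq_vanish vf => n; rewrite difs_dif.
Qed.

Definition coefs (K L : nat) : seq Z :=
  let one := deltaZ K 0 in
  let p3 := foldr divZ one (iota 3 L) in
  let p2 := divZ 2 p3 in
  let b := divZ L (subZ p3 one) in
  subZ (subZ p2 p3) (subZ b (deltaZ K 3)).

Lemma lists_parts_in K s k : (0 < s)%N ->
  lists (foldr divZ (deltaZ K 0) (iota s k)) (parts_in s k).
Proof.
elim: k s => [|k IHk] s s0 /=.
  by move=> n nK; rewrite parts_in0; apply: lists_delta.
by apply: lists_div (IHk _ _) => //; apply: dif_parts_in_low.
Qed.

Lemma lists_coefs K L : (0 < L)%N -> lists (coefs K L) (G2 L \+ qpow 3).
Proof.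
move=> L0.
have p2 := @lists_parts_in K 2 L.+1 isT; have p3 := @lists_parts_in K 3 L isT.
have lb := lists_div L0 (@dif_span3 L) (lists_sub p3 (@lists_delta K 0)).
move=> n nK; rewrite -(lists_sub (lists_sub p2 p3) (lists_sub lb (@lists_delta K 3))) //.
by rewrite /= G2E /=; congr Z_of_int; ring.
Qed.

(** The bound 320 exceeds the degree of the last product for all L <= 10, and
the longest window ends at 380 = 320 + 60. *)
Definition certificate (L : nat) : bool :=
  let l := coefs 380 L in
  let s := L :: iota 6 (L - 3) ++ nseq 4 60 in
  [&& all (leq 1) s, all2 dvdn (denoms L) s, (sumn s + 4 <= 320)%N,
      all (Z.leb 0) (take 320 (drop 0 l)), (320 <= size l)%N & windows 320 s l].

Lemma certificateP L : (5 <= L)%N -> certificate L ->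
  forall n, 0 <= (G2 L \+ qpow 3) n.
Proof.
move=> L5 /and5P[s0 ds s320 small /andP[szl wins]] n.
have lf : lists (coefs 380 L) (G2 L \+ qpow 3) by apply: lists_coefs; lia.
have [n320|] := ltnP n 320; first by apply: (lists_ge0 (i := 0) lf szl small).
apply: (windows_ge0 lf _ wins); apply: vanish_le s320 _.
by apply: vanish_difs_dvd s0 ds _; apply: vanish_G2.
Qed.

Theorem theorem19 (L : nat) (hL : (5 <= L <= 10)%N) (n : nat) :
  0 <= (G2 L \+ qpow 3) n.
Proof.
have /allP cert : all certificate (iota 5 6) by vm_compute.
by apply: certificateP; [lia | apply: cert; rewrite mem_iota; lia].
Qed.
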